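(* Fix $\varepsilon>0$ and $\gamma\in(0,1)$, and let $d_N=(1-\gamma)\sqrt{\frac{\log N}{2\log\log N}}$. Let $G$ be the cyclic group of order $N$, let $d$ be an integer with $2\leqslant d\leqslant d_N$, and let $\Gamma\in\mathcal{G}(G,p)$ with $p\geqslant\sqrt[d]{\frac{d!(1+\varepsilon)}{2^d}\cdot\frac{\log N}{N^{d-1}}}$. Then with high probability the diameter of $\Gamma$ is at most $d$; that is, $\Pr(\operatorname{diam}(\Gamma)>d)\to0$ as $N\to\infty$, uniformly over all such $d$ and $p$.
   Context: For a group $G$ and a subset $S\subseteq G$, the (undirected) Cayley graph $\Gamma(G;S)$ has vertex set $G$ and an edge between $g\neq h$ iff $g^{-1}h\in S$ or $h^{-1}g\in S$ (loops and multiple edges ignored). The model $\mathcal{G}(G,p)$ is the probability space of Cayley graphs $\Gamma(G;S)$ where each element of $G$ is put in $S$ independently with probability $p$. The diameter of a disconnected graph is infinite. *)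

(* Defs.v *)
From HB Require Import structures.
From mathcomp Require Import all_boot all_order all_algebra.
From mathcomp Require Import all_classical all_reals all_analysis.
Set Implicit Arguments. Unset Strict Implicit. Unset Printing Implicit Defensive.
Import Order.TTheory GRing.Theory Num.Theory.
Local Open Scope ring_scope.

(* Cyclic group of order N realised as the additive group 'Z_N (N >= 2). *)

Definition cayley_adj (G : zmodType) (S : G -> bool) (g h : G) : bool :=
  (g != h) && (S (h - g) || S (g - h)).

Definition dist_le (G : finZmodType) (S : {set G}) (k : nat) (x y : G) : Prop :=
  exists s : seq G, (size s <= k)%N /\ path (cayley_adj (mem S)) x s /\ last x s = y.

(* diam(Gamma(G;S)) <= k  (infinite diameter for disconnected graphs never satisfies it) *)
Definition diam_le (G : finZmodType) (S : {set G}) (k : nat) : Prop :=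
  forall x y : G, dist_le S k x y.

(* Probability of the set S in the model G(G,p): each element independently with prob. p *)
Definition setprob (R : realType) (G : finType) (p : R) (S : {set G}) : R :=
  \prod_(g : G) (if g \in S then p else 1 - p).

Definition prob_diam_gt (R : realType) (G : finZmodType) (p : R) (k : nat) : R :=
  \sum_(S : {set G} | ~~ `[< diam_le S k >]) setprob p S.

Definition dN (R : realType) (gamma : R) (N : nat) : R :=
  (1 - gamma) * Num.sqrt (ln (N%:R) / (2 * ln (ln (N%:R)))).

Definition p_threshold (R : realType) (eps : R) (N d : nat) : R :=
  ((d`!)%:R * (1 + eps) / (2 ^+ d) * (ln (N%:R) / (N%:R ^+ d.-1))) `^ (d%:R)^-1.

(* Main.v *)
Require Import Defs.
From HB Require Import structures.
From mathcomp Require Import all_boot all_order all_algebra.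
From mathcomp Require Import all_classical all_reals all_analysis.
From mathcomp Require Import zify ring lra.
From mathcomp Require Import fintype finset.
Import Order.TTheory GRing.Theory Num.Theory.
Local Open Scope ring_scope.
Set Implicit Arguments.
Unset Strict Implicit.
Unset Printing Implicit Defensive.

(** The diameter exceeds [d] only if some [g != 0] is not a signed sum of [d]
elements of [S], so it suffices to bound the failure probability of each [g].
By Janson's inequality that probability is at most [exp (- mu (1 - rho))], where
[mu] is the expected number of [d]-subsets of [S] with a signed sum equal to [g]
and [rho] measures the overlaps. Counting tuples gives
[mu = (1 + eps) log N (1 + O(1 / log N))], and the bound on [d] makes
[N p >= (log N)^(2 d)], whence [rho = O(1 / log N)]; a union bound over [g]
concludes. The element of order two is exceptional: a sign vector and its
opposite then represent [g] by the same sets, so [mu] is halved, which is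
harmless for a single [g]. *)

(** * Product measures on the subsets of a finite type *)

Section ProductMeasure.
Context {R : realType} {G : finType}.
Implicit Types (P : G -> R) (p : R) (S T : {set G}) (h : {set G} -> R).

(** Each element has its own probability, so that [expect_antitone] can interpolate between two
    constant ones; [setprob p] is the constant case. *)
Definition weight P S : R := \prod_g (if g \in S then P g else 1 - P g).

Definition weight_off P x S : R :=
  \prod_(g | g != x) (if g \in S then P g else 1 - P g).

Definition expect p h : R := \sum_S setprob p S * h S.

Lemma weight_off_setU1 P x S : weight_off P x (x |: S) = weight_off P x S.
Proof. by apply: eq_bigr => g /negbTE gx; rewrite !inE gx. Qed.

Lemma weight_off_ge0 P x S :
  (forall g, 0 <= P g <= 1) -> 0 <= weight_off P x S.
Proof.
move=> P01; apply: prodr_ge0 => g _; have /andP[P0 P1] := P01 g.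
by case: ifP => // _; rewrite subr_ge0.
Qed.

Lemma weightD1 P x S :
  weight P S = (if x \in S then P x else 1 - P x) * weight_off P x S.
Proof. by rewrite /weight (bigD1 x). Qed.

(** Pairing [S] with [x |: S] conditions on everything but the membership of [x]: [weight_off P x]
    takes the same value on both. *)
Lemma sum_weight_split P x h :
  \sum_S weight P S * h S =
  \sum_(S : {set G} | x \notin S)
    weight_off P x S * (P x * h (x |: S) + (1 - P x) * h S).
Proof.
rewrite (bigID (fun S : {set G} => x \in S)) /=.
rewrite (reindex_onto (fun S => x |: S) (fun S => S :\ x)) /=; last first.
  by move=> S xS; rewrite setD1K.
rewrite (eq_bigl (fun S : {set G} => x \notin S)); last first.
  move=> S; rewrite setU11 /=; apply/eqP/idP => [<-|xS]; first by rewrite !inE eqxx.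
  by rewrite setU1K.
rewrite -big_split /=; apply: eq_bigr => S xS.
rewrite !(weightD1 _ x) setU11 (negbTE xS) weight_off_setU1; ring.
Qed.

Lemma expect_split p x h :
  expect p h = \sum_(S : {set G} | x \notin S)
    weight_off (fun=> p) x S * (p * h (x |: S) + (1 - p) * h S).
Proof. exact: (sum_weight_split (fun=> p)). Qed.

Lemma setprob_ge0 p S : 0 <= p <= 1 -> 0 <= setprob p S.
Proof.
move=> /andP[p0 p1]; apply: prodr_ge0 => g _.
by case: ifP => // _; rewrite subr_ge0.
Qed.

Lemma eq_expect p h1 h2 : h1 =1 h2 -> expect p h1 = expect p h2.
Proof. by move=> eqh; apply: eq_bigr => S _; rewrite eqh. Qed.

Lemma le_expect p h1 h2 : 0 <= p <= 1 -> (forall S, h1 S <= h2 S) ->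
  expect p h1 <= expect p h2.
Proof. by move=> p01 leh; apply: ler_sum => S _; rewrite ler_wpM2l ?setprob_ge0. Qed.

Lemma expect_ge0 p h : 0 <= p <= 1 -> (forall S, 0 <= h S) -> 0 <= expect p h.
Proof. by move=> p01 h0; apply: sumr_ge0 => S _; rewrite mulr_ge0 ?setprob_ge0. Qed.

Lemma expectB p h1 h2 : expect p (fun S => h1 S - h2 S) = expect p h1 - expect p h2.
Proof. by rewrite /expect -sumrB; apply: eq_bigr => S _; rewrite mulrBr. Qed.

Lemma expect_sum p (I : Type) (r : seq I) (Q : pred I) (h : I -> {set G} -> R) :
  expect p (fun S => \sum_(i <- r | Q i) h i S) = \sum_(i <- r | Q i) expect p (h i).
Proof. by rewrite /expect exchange_big; apply: eq_bigr => S _; rewrite mulr_sumr. Qed.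

Lemma expect_mem p x h :
  expect p (fun S => (x \in S)%:R * h S) = p * expect p (fun S => h (x |: S)).
Proof.
rewrite !(expect_split p x) mulr_sumr; apply: eq_bigr => S xS.
rewrite setU11 (negbTE xS) setUA setUid mul1r mul0r mulr0 addr0.
by rewrite -mulrDl addrC subrK mul1r mulrCA.
Qed.

(* Planting: conditioning on [T \subset S] amounts to adding [T] to [S]. *)
Lemma expect_subset p T h :
  expect p (fun S => (T \subset S)%:R * h S) =
  p ^+ #|T| * expect p (fun S => h (T :|: S)).
Proof.
have [n] := ex_intro (fun n => #|T| = n) _ erefl.
elim: n T h => [|n IH] T h cT; rewrite cT.
  rewrite mul1r; apply: eq_expect => S.
  by rewrite (cards0_eq cT) sub0set mul1r set0U.
have /card_gt0P[x xT] : (0 < #|T|)%N by rewrite cT.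
have cT' : #|T :\ x| = n by move: cT; rewrite (cardsD1 x) xT => -[].
rewrite (@eq_expect p _ (fun S =>
  (T :\ x \subset S)%:R * ((x \in S)%:R * h S))); last first.
  move=> S; rewrite mulrA -natrM mulnb -{1}(setD1K xT) subUset sub1set.
  by rewrite andbC.
rewrite IH // cT' (@eq_expect p _ (fun S =>
  (x \in S)%:R * h (T :\ x :|: S))); last by move=> S; rewrite !inE eqxx.
rewrite expect_mem mulrA -exprSr; congr (_ * _); apply: eq_expect => S.
by rewrite setUCA setUA setD1K.
Qed.

(** Planting [T] can only lower a decreasing [h]; this is the correlation inequality in Janson's
    argument. *)
Lemma expect_subset_le p T h : 0 <= p <= 1 ->
  (forall S S', S \subset S' -> h S' <= h S) ->
  expect p (fun S => (T \subset S)%:R * h S) <= p ^+ #|T| * expect p h.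
Proof.
move=> p01 hdec; rewrite expect_subset ler_wpM2l ?exprn_ge0 //.
  by case/andP: p01.
by apply: le_expect => // S; apply: hdec; rewrite subsetUr.
Qed.

Lemma expect_subset_indep p T h : (forall S, h (T :|: S) = h S) ->
  expect p (fun S => (T \subset S)%:R * h S) = p ^+ #|T| * expect p h.
Proof. by move=> hT; rewrite expect_subset (eq_expect _ hT). Qed.

(** Probabilities are raised from [p] to [q] one element at a time; a step shifts mass from [h S] to
    [h (x |: S)], which is no larger. *)
Lemma expect_antitone p q h : 0 <= p -> p <= q -> q <= 1 ->
  (forall S S', S \subset S' -> h S' <= h S) ->
  expect q h <= expect p h.
Proof.
move=> p0 pq q1 hdec.
have P01 A g : 0 <= (if g \in (A : {set G}) then q else p) <= 1.
  by case: ifP => _; rewrite ?q1 ?p0 ?(le_trans p0 pq) ?(le_trans pq q1).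
pose E A := \sum_S weight (fun g => if g \in (A : {set G}) then q else p) S * h S.
suff EA (A : {set G}) : E A <= E set0.
  have -> : expect q h = E setT.
    by apply: eq_bigr => S _; congr (_ * _); apply: eq_bigr => g _; rewrite inE.
  apply: (le_trans (EA _)); rewrite le_eqVlt; apply/orP; left; apply/eqP.
  by apply: eq_bigr => S _; congr (_ * _); apply: eq_bigr => g _; rewrite inE.
have [n] := ex_intro (fun n => #|A| = n) _ erefl.
elim: n A => [|n IH] A cA; first by rewrite (cards0_eq cA).
have /card_gt0P[x xA] : (0 < #|A|)%N by rewrite cA.
have cA' : #|A :\ x| = n by move: cA; rewrite (cardsD1 x) xA => -[].
apply: le_trans (IH _ cA'); rewrite /E !(sum_weight_split _ x).
apply: ler_sum => S xS; rewrite xA !inE eqxx /=.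
have -> : weight_off (fun g => if g \in A then q else p) x S =
          weight_off (fun g => if g \in A :\ x then q else p) x S.
  by apply: eq_bigr => g gx; rewrite !inE gx.
rewrite ler_wpM2l ?weight_off_ge0 //.
have := hdec S (x |: S) (subsetUr _ _); nra.
Qed.

(** * Janson's inequality *)

Definition avoids (r : seq {set G}) S : R := (all (fun T => ~~ (T \subset S)) r)%:R.

Lemma avoids_ge0 r S : 0 <= avoids r S.
Proof. exact: ler0n. Qed.

Lemma avoids_antitone r S S' : S \subset S' -> avoids r S' <= avoids r S.
Proof.
move=> SS'; rewrite ler_nat; case: (boolP (all _ _)) => // /allP rS'.
rewrite [X in (_ <= nat_of_bool X)%N](_ : _ = true) //; apply/allP => T /rS'.
by apply: contra => TS; exact: subset_trans TS SS'.
Qed.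

(* One step of Janson's inequality: the sets of [r] disjoint from [T] are
   independent of [T], the others are removed by a union bound. *)
Lemma expect_avoids_cons p T r : 0 <= p <= 1 ->
  expect p (avoids (T :: r)) <=
  (1 - (p ^+ #|T| - \sum_(T' <- r | ~~ [disjoint T & T']) p ^+ #|T :|: T'|))
  * expect p (avoids r).
Proof.
move=> p01; set D := \sum_(_ <- _ | _) _.
have -> : expect p (avoids (T :: r)) =
  expect p (avoids r) - expect p (fun S => (T \subset S)%:R * avoids r S).
  rewrite -expectB; apply: eq_expect => S; rewrite /avoids /=.
  by case: (T \subset S); rewrite /= ?mul1r ?mul0r ?subrr ?subr0.
rewrite mulrBl mul1r lerD2l lerN2.
have [Dlt|Dge] := ltP (p ^+ #|T| - D) 0.
  apply: (@le_trans _ _ 0).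
    by rewrite nmulr_rle0 // expect_ge0 // => S; exact: avoids_ge0.
  by apply: expect_ge0 => // S; rewrite mulr_ge0 ?avoids_ge0.
pose c := [seq T' : {set G} <- r | [disjoint T & T']].
apply: (@le_trans _ _ ((p ^+ #|T| - D) * expect p (avoids c))).
  rewrite ler_wpM2l //; apply: le_expect => // S.
  rewrite ler_nat; case: (boolP (all _ r)) => // /allP rS.
  rewrite [X in (_ <= nat_of_bool X)%N](_ : _ = true) //; apply/allP => T'.
  by rewrite mem_filter => /andP[_]; exact: rS.
have cT S : avoids c (T :|: S) = avoids c S.
  congr (nat_of_bool _)%:R; apply: eq_in_all => T'; rewrite mem_filter => /andP[dT _].
  congr (~~ _); apply/idP/idP => [|/subset_trans-> //]; last exact: subsetUr.
  move=> /subsetP sT; apply/subsetP => y yT'.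
  have := sT y yT'; rewrite inE => /orP[yT|//].
  by move: dT; rewrite disjoint_sym => /pred0P/(_ y); rewrite /= yT yT'.
rewrite mulrBl -(@expect_subset_indep p T) // mulr_suml.
(* If [S] contains [T] and avoids [c], any set of [r] inside [S] must meet [T]; the subtracted terms
   are the union bound over such sets. *)
apply: (@le_trans _ _ (expect p (fun S => (T \subset S)%:R * avoids c S) -
  \sum_(T' <- r | ~~ [disjoint T & T'])
     expect p (fun S => (T :|: T' \subset S)%:R * avoids c S))).
  rewrite lerD2l lerN2; apply: ler_sum => T' _.
  by apply: expect_subset_le => // *; exact: avoids_antitone.
rewrite -expect_sum -expectB; apply: le_expect => // S.
have [TS|_] := boolP (T \subset S); last first.
  rewrite !mul0r sub0r oppr_le0; apply: sumr_ge0 => T' _.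
  by rewrite mulr_ge0 ?avoids_ge0.
rewrite !mul1r; have [rS|] := boolP (all (fun T' => ~~ (T' \subset S)) r).
  rewrite /avoids rS; apply: (@le_trans _ _ (avoids c S)).
    rewrite gerBl; apply: sumr_ge0 => T' _.
    by rewrite mulr_ge0 ?avoids_ge0.
  by rewrite /avoids lern1 leq_b1.
move=> /allPn[T' T'r]; rewrite negbK => T'S.
have [cS|] := boolP (all (fun T' => ~~ (T' \subset S)) c); last first.
  move=> /negbTE cS; rewrite /avoids cS sub0r.
  apply: (@le_trans _ _ 0); last by [].
  by rewrite oppr_le0; apply: sumr_ge0 => ? _; rewrite mulr0.
apply: (@le_trans _ _ 0); last exact: avoids_ge0.
rewrite /avoids cS subr_le0 (big_rem T') //=.
have -> : ~~ [disjoint T & T'].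
  apply: contraL cS => dT; apply/allPn; exists T'; last by rewrite negbK.
  by rewrite mem_filter dT.
rewrite subUset TS T'S mul1r lerDl; apply: sumr_ge0 => ? _.
by rewrite mulr1.
Qed.

(** The avoidance conditions are added one at a time; each costs a factor at most [1 - (p ^+ d -
    delta) <= expR (- (p ^+ d - delta))]. *)
Lemma janson p (F : {set {set G}}) d delta : 0 <= p <= 1 ->
  {in F, forall T, #|T| = d} ->
  {in F, forall T, \sum_(T' in F | (T' != T) && ~~ [disjoint T & T'])
     p ^+ #|T :|: T'| <= delta} ->
  expect p (avoids (enum F)) <= expR (- (#|F|%:R * (p ^+ d - delta))).
Proof.
move=> p01 Fd Fdelta; have p0 : 0 <= p by case/andP: p01.
rewrite cardE; have := enum_uniq F.
have : {subset enum F <= F} by move=> T; rewrite mem_enum.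
elim: (enum F) => [|T r IH] rF /=.
  move=> _; rewrite mul0r oppr0 expR0 /expect.
  under eq_bigr do rewrite mulr1.
  rewrite -(bigA_distr _ _ (fun=> p) (fun=> 1 - p)) big1 // => g _.
  by rewrite /= addrC subrK.
move=> /andP[Tr ur]; apply: (le_trans (expect_avoids_cons _ _ p01)).
have TF : T \in F by apply: rF; rewrite mem_head.
have rF' : {subset r <= F} by move=> T' T'r; apply: rF; rewrite inE T'r orbT.
rewrite -[(size r).+1%:R]natr1 [X in expR (- X)]mulrDl mul1r.
rewrite [X in expR X]opprD expRD [leRHS]mulrC.
have D0 : 0 <= \sum_(T' <- r | ~~ [disjoint T & T']) p ^+ #|T :|: T'|.
  by apply: sumr_ge0 => T' _; rewrite exprn_ge0.
have pT1 : p ^+ #|T| <= 1 by rewrite exprn_ile1 //; case/andP: p01.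
apply: ler_pM.
- lra.
- by apply: expect_ge0 => // S; exact: avoids_ge0.
- apply: le_trans (expR_ge1Dx _); rewrite lerD2l lerN2 (Fd _ TF).
  rewrite lerD2l lerN2; apply: le_trans (Fdelta _ TF).
  (* The sets left in [r] lie in [F] and differ from [T], so their overlap sum is part of the one
     bounded by [delta]. *)
  rewrite [leRHS]big_mkcondr /= [leRHS](bigID (mem r)) /=.
  apply: ler_wpDr.
    by apply: sumr_ge0 => T' _; case: ifP => // _; rewrite exprn_ge0.
  rewrite [leLHS]big_mkcond /= big_uniq //= [leRHS]big_mkcond /=.
  rewrite [leLHS]big_mkcond /=; apply: ler_sum => T' _.
  have [T'r|_] := boolP (T' \in r); last by rewrite andbF.
  by rewrite (rF' _ T'r) /= (memPn Tr).
- exact: IH.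
Qed.
End ProductMeasure.

(** * Counting solutions of signed sum equations *)

Lemma card_family_prod (aT rT : finType) (F : aT -> pred rT) :
  #|family F| = (\prod_a #|F a|)%N.
Proof. by rewrite card_family foldrE big_map big_enum. Qed.

Section SignedSums.
Context {G : finZmodType} {d : nat}.
Implicit Types (s : {ffun 'I_d -> bool}) (x y : {ffun 'I_d -> G}) (g : G).
Implicit Types (T : {set G}) (Sg : {set {ffun 'I_d -> bool}}).

(** [s a = true] subtracts the coordinate [x a]. Signs occur because an undirected edge is a step by
    an element of [S] or by its negative. *)
Definition sgsum s x : G := \sum_a (if s a then - x a else x a).

Lemma sgsum_inj_off s x y b :
  (forall a, a != b -> x a = y a) -> sgsum s x = sgsum s y -> x = y.
Proof.
move=> xy; rewrite /sgsum !(bigD1 b (P := predT)) //=.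
rewrite (eq_bigr (fun a => if s a then - y a else y a)); last first.
  by move=> a ab; rewrite xy.
move=> /addIr eb; apply/ffunP => a; have [->|/xy //] := eqVneq a b.
by move: eb; case: (s b) => // /oppr_inj.
Qed.

(** Some index [b] lies outside [A]. The equation determines its coordinate, those in [A] range over
    [T], and the other [(d - #|A|).-1] are free. *)
Lemma card_sgsum_in s g (A : {set 'I_d}) T : A != setT ->
  (#|[set x | (sgsum s x == g) && [forall a in A, x a \in T]]|
     <= #|T| ^ #|A| * #|G| ^ (d - #|A|).-1)%N.
Proof.
move=> AT; have [b bA] : exists b, b \notin A.
  apply/existsP; rewrite -negb_forall; apply: contra AT => /forallP AT.
  by apply/eqP/setP => b; rewrite AT inE.
pose f x : {ffun 'I_d -> G} := [ffun a => if a == b then 0 else x a].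
pose H a : pred G := fun u => if a == b then u == 0 else (a \in A) ==> (u \in T).
rewrite -(card_in_imset (f := f)); last first.
  move=> x y; rewrite !inE => /andP[/eqP xg _] /andP[/eqP yg _] fxy.
  apply: (sgsum_inj_off (s := s) (b := b)); last by rewrite xg.
  by move=> a ab; move/ffunP/(_ a): fxy; rewrite !ffunE (negbTE ab).
apply: (@leq_trans #|family H|).
  apply: subset_leq_card; apply/subsetP => y /imsetP[x].
  rewrite inE => /andP[_ /forall_inP xA] ->; apply/familyP => a.
  rewrite ffunE unfold_in /H; case: eqP => // _.
  by apply/implyP => /xA.
rewrite card_family_prod (bigID (mem A)) /= [X in (_ * X)%N](bigD1 b) //=.
have -> : #|H b| = 1%N.
  by rewrite -(card1 (0 : G)); apply: eq_card => u; rewrite !unfold_in /H eqxx.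
rewrite mul1n.
rewrite (eq_bigr (fun=> #|T|)); last first.
  move=> a aA; apply: eq_card => u; rewrite unfold_in /H aA.
  by case: eqP => [ab|//]; rewrite -ab aA in bA.
rewrite [X in (_ * X)%N](eq_bigr (fun=> #|G|)); last first.
  move=> a /andP[/negbTE aA /negbTE ab].
  by apply: eq_card => u; rewrite unfold_in /H aA ab.
rewrite !prod_nat_const leq_mul2l; apply/orP; right.
rewrite [X in (_ ^ X <= _)%N](_ : _ = (d - #|A|).-1) //.
rewrite (_ : (d - #|A|)%N = #|~: A|); last first.
  by have /(congr1 (subn^~ #|A|)) := cardsC A; rewrite addKn card_ord.
rewrite (cardsD1 b (~: A)) inE bA /=.
by apply: eq_card => a; rewrite !inE andbC.
Qed.

(** The upper bound holds for every value, and the counts over all values add up to [#|G| ^ d], so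
    none of the bounds is strict. *)
Lemma card_sgsum s g : (0 < d)%N -> #|[set x | sgsum s x == g]| = (#|G| ^ d.-1)%N.
Proof.
move=> d0; have le g' : (#|[set x | sgsum s x == g']| <= #|G| ^ d.-1)%N.
  have := @card_sgsum_in s g' set0 set0; rewrite !cards0 subn0 mul1n.
  rewrite eq_sym -cards_eq0 cardsT card_ord -lt0n => /(_ d0).
  apply: leq_trans; apply: subset_leq_card; apply/subsetP => x; rewrite !inE => ->.
  by apply/forall_inP => a; rewrite inE.
apply/eqP; rewrite eqn_leq le /=.
have tot : (\sum_g' #|[set x | sgsum s x == g']| = #|G| ^ d)%N.
  rewrite -[in RHS](card_ord d) -card_ffun -sum1_card.
  rewrite (partition_big (sgsum s) predT) //=; apply: eq_bigr => g' _.
  by rewrite -sum1_card; apply: eq_bigl => x; rewrite inE.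
rewrite -(leq_add2r ((#|G|.-1) * #|G| ^ d.-1)) -mulSn prednK; last first.
  by apply/card_gt0P; exists 0.
rewrite -expnS prednK // -tot (bigD1 g) //= leq_add2l.
rewrite -(cardC1 g) -sum_nat_const; exact: leq_sum.
Qed.

(** Common shape of the two degenerate counts below: two coordinates are recovered from the [d - 2]
    others and one bit. *)
Lemma card_two_off (X : {set {ffun 'I_d -> G}}) a b
    (bit : {ffun 'I_d -> G} -> bool) : a != b ->
  {in X &, forall x y, (forall c, c != a -> c != b -> x c = y c) ->
     bit x = bit y -> x = y} ->
  (#|X| <= 2 * #|G| ^ (d - 2))%N.
Proof.
move=> ab Xinj.
pose f x : {ffun 'I_d -> G} := [ffun c => if c \in [set a; b] then 0 else x c].
rewrite -(card_in_imset (f := fun x => (bit x, f x))); last first.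
  move=> x y xX yX [bxy /ffunP fxy]; apply: Xinj => // c ca cb.
  by have := fxy c; rewrite !ffunE !inE (negbTE ca) (negbTE cb).
pose Y := pffun_on 0 (mem (~: [set a; b])) (@predT G).
apply: (@leq_trans #|setX [set: bool] [set x in Y]|).
  apply: subset_leq_card; apply/subsetP => _ /imsetP[x xX ->].
  rewrite !inE /=; apply/pffun_onP; split=> //; apply/subsetP => c.
  by rewrite !inE ffunE !inE; case: ifP => // _; rewrite eqxx.
rewrite cardsX cardsT card_bool cardsE card_pffun_on leq_mul2l /=.
have -> : #|@predT G| = #|G| by apply: eq_card.
rewrite [X in (_ ^ X <= _)%N](_ : _ = (d - 2)%N) //.
have /(congr1 (subn^~ 2)) := cardsC [set a; b].
by rewrite cards2 ab addKn card_ord => <-; apply: eq_card.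
Qed.

(* In a cyclic group doubling is at most two-to-one, so one bit recovers [u] from [u + u]. *)
Variable bit : G -> bool.
Hypothesis bit_inj : forall u v, u + u = v + v -> bit u = bit v -> u = v.

(** A third coordinate [x k] is solved from the equation once [x j = x i] is known. If [d = 2], the
    equation reads [x i + x i = g] up to sign, where the bit decides, or [0 = g], which is
    excluded. *)
Lemma card_sgsum_coincide s g i j : g != 0 -> i != j ->
  (#|[set x | (sgsum s x == g) && (x i == x j)]| <= 2 * #|G| ^ (d - 2))%N.
Proof.
move=> g0 ij; have [k /andP[ki kj]|all_ij] := pickP (fun k => (k != i) && (k != j)).
  apply: (@card_two_off _ j k (fun=> true)); first by rewrite eq_sym.
  move=> x y; rewrite !inE => /andP[/eqP xg /eqP xij] /andP[/eqP yg /eqP yij] xy _.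
  apply: (sgsum_inj_off (s := s) (b := k)); last by rewrite xg.
  move=> a ak; have [->|aj] := eqVneq a j; last exact: xy.
  by rewrite -xij -yij xy // eq_sym.
apply: (@card_two_off _ i j (fun x => bit (x i))) => // x y.
have sumE (z : {ffun 'I_d -> G}) : z i = z j ->
    sgsum s z = (if s i then - z i else z i) + (if s j then - z i else z i).
  move=> zij; rewrite /sgsum (bigD1 i) //= (bigD1 j) ?(eq_sym j) //= big_pred0 ?addr0 ?zij //.
rewrite !inE => /andP[/eqP xg /eqP xij] /andP[/eqP yg /eqP yij] xy bxy.
have xyi : x i = y i.
  move: xg yg; rewrite !sumE //; case: (s i); case: (s j);
    rewrite ?addNr ?subrr => eg; try by rewrite -eg eqxx in g0.
    by rewrite -eg -!opprD => /oppr_inj e; apply: bit_inj.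
  by rewrite -eg => e; apply: bit_inj.
apply/ffunP => c; have := all_ij c; have [->//|/= _] := eqVneq c i.
by move/negbFE/eqP->; rewrite -xij -yij.
Qed.

(** Subtracting the two equations cancels coordinate [b] and leaves twice [x a] up to sign, so the
    bit gives [x a]; either equation then gives [x b]. *)
Lemma card_sgsum_two s s' g a b : s a != s' a -> s b = s' b ->
  (#|[set x | (sgsum s x == g) && (sgsum s' x == g)]| <= 2 * #|G| ^ (d - 2))%N.
Proof.
move=> sa sb; have ab : a != b by apply: contraNneq sa => ->; rewrite sb.
apply: (@card_two_off _ a b (fun x => bit (x a))) => // x y.
rewrite !inE => /andP[/eqP xg /eqP xg'] /andP[/eqP yg /eqP yg'] xy bxy.
have xya : x a = y a.
  have : sgsum s x - sgsum s' x = sgsum s y - sgsum s' y by rewrite xg xg' yg yg'.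
  rewrite /sgsum -!sumrB !(bigD1 a (P := predT)) //=.
  rewrite (eq_bigr (fun c => (if s c then - y c else y c) -
                            (if s' c then - y c else y c))); last first.
    move=> c ca; have [->|cb] := eqVneq c b; first by rewrite sb !subrr.
    by rewrite xy.
  move=> /addIr; move: sa; case: (s a); case: (s' a) => // _.
    by rewrite -!opprD => /oppr_inj e; apply: bit_inj.
  by rewrite !opprK => e; apply: bit_inj.
apply: (sgsum_inj_off (s := s) (b := b)); last by rewrite xg.
by move=> c cb; have [->//|ca] := eqVneq c a; apply: xy.
Qed.

Lemma sgsum_negate s s' x : (forall b, s b != s' b) -> sgsum s' x = - sgsum s x.
Proof.
move=> ss'; rewrite /sgsum -sumrN; apply: eq_bigr => b _.
by have := ss' b; case: (s b); case: (s' b); rewrite ?opprK.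
Qed.

(** * Sets that represent a group element *)

(** [Sg] restricts the admissible signs, so that only one of two opposite sign vectors need be kept
    when [g + g = 0]. *)
Definition repsets Sg g : {set {set G}} :=
  [set T | [exists s in Sg, exists x : {ffun 'I_d -> G},
     [&& injectiveb x, sgsum s x == g & T == [set x a | a : 'I_d]]]].

Lemma repsetsP Sg g T : reflect
  (exists s x, [/\ s \in Sg, injective x, sgsum s x = g & T = [set x a | a : 'I_d]])
  (T \in repsets Sg g).
Proof.
rewrite inE; apply: (iffP exists_inP).
  move=> [s sS /existsP[x /and3P[/injectiveP xi /eqP xg /eqP ->]]].
  by exists s, x.
move=> [s [x [sS xi xg ->]]]; exists s => //; apply/existsP; exists x.
by rewrite xg !eqxx !andbT; apply/injectiveP.
Qed.

Lemma card_repsets_mem Sg g T : T \in repsets Sg g -> #|T| = d.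
Proof. by move=> /repsetsP[s [x [_ xi _ ->]]]; rewrite card_imset // card_ord. Qed.

Lemma card_inj_image_in (F : {set {set G}}) : {in F, forall T, #|T| = d} ->
  (#|[set x : {ffun 'I_d -> G} | injectiveb x & [set x a | a : 'I_d] \in F]|
    <= #|F| * d`!)%N.
Proof.
move=> Fd; rewrite -sum1_card.
rewrite (partition_big (fun x : {ffun 'I_d -> G} => [set x a | a : 'I_d]) (mem F)) /=;
  last by move=> x; rewrite inE => /andP[].
rewrite -sum_nat_const; apply: leq_sum => T TF.
rewrite sum1_card -[X in (_ <= X`!)%N](Fd T TF) -ffactnn.
rewrite -[X in (_ ^_ X)%N](_ : #|'I_d| = _); last by rewrite card_ord Fd.
rewrite -card_inj_ffuns_on; apply: subset_leq_card; apply/subsetP => x.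
rewrite unfold_in !inE => /andP[/andP[xi _] /eqP xT]; rewrite xi andbT.
by apply/ffun_onP => a; rewrite -xT; apply: imset_f.
Qed.

(** Each [s] in [Sg] has [#|G| ^ d.-1] solutions. Dropping those with a repeated coordinate (at most
    [d ^ 2] index pairs) or shared with another sign vector (at most [2 ^ d]) leaves enumerations of
    represented sets, at most [d] factorial per set. *)
Lemma card_repsets Sg g : (1 < d)%N -> g != 0 ->
  {in Sg &, forall s s', (exists b, s b = s' b) \/ g + g != 0} ->
  (#|Sg| * #|G| ^ d.-1 <=
    #|repsets Sg g| * d`! + #|Sg| * ((d ^ 2 + 2 ^ d) * (2 * #|G| ^ (d - 2))))%N.
Proof.
move=> d1 g0 Sg_ok; set M := (2 * #|G| ^ (d - 2))%N.
(* The [x] in [J s] are enumerations of a set for which [s] is the only valid sign. *)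
pose J s := [set x | [&& sgsum s x == g, injectiveb x &
  [forall (s' | (s' \in Sg) && (s' != s)), sgsum s' x != g]]].
have leJ s : s \in Sg -> (#|G| ^ d.-1 <= #|J s| + (d ^ 2 + 2 ^ d) * M)%N.
  move=> sS; rewrite -(card_sgsum s g) ?(ltnW d1) //.
  pose X1 (ij : 'I_d * 'I_d) := [set x | (sgsum s x == g) && (x ij.1 == x ij.2)].
  pose X2 s' := [set x | (sgsum s x == g) && (sgsum s' x == g)].
  apply: (@leq_trans (#|J s| + (\sum_(ij | ij.1 != ij.2) #|X1 ij| +
                      \sum_(s' in Sg | s' != s) #|X2 s'|))).
    have cE (X : {set {ffun 'I_d -> G}}) : #|X| = (\sum_x (x \in X))%N.
      by rewrite -sum1_card big_mkcond; apply: eq_bigr => x _; case: (x \in X).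
    rewrite (cE (J s)) [X in (X <= _)%N]cE (eq_bigr _ (fun ij _ => cE (X1 ij))).
    rewrite [X in (_ <= _ + (_ + X))%N](eq_bigr _ (fun s' _ => cE (X2 s'))).
    rewrite exchange_big [X in (_ <= _ + (_ + X))%N]exchange_big /=.
    rewrite -!big_split /=; apply: leq_sum => x _; rewrite inE.
    have [xg|//] := boolP (sgsum s x == g).
    have [xJ|] := boolP (x \in J s); first by rewrite leq_addr.
    rewrite inE xg /= negb_and add0n => /orP[|].
      move=> /injectivePn[i [j ij xij]]; rewrite (bigD1 (i, j)) //= inE xg xij eqxx.
      by rewrite -addnA leq_addr.
    move=> /forall_inPn[s' s'S]; rewrite negbK => xg'.
    by rewrite addnC (bigD1 s') //= inE xg xg' -addnA leq_addr.
  rewrite leq_add2l mulnDl leq_add //.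
    apply: (@leq_trans (\sum_(ij : 'I_d * 'I_d | ij.1 != ij.2) M)).
      by apply: leq_sum => ij ij12; apply: card_sgsum_coincide.
    rewrite sum_nat_const leq_mul2r; apply/orP; right.
    by apply: leq_trans (max_card _) _; rewrite card_prod card_ord.
  apply: (@leq_trans (\sum_(s' in Sg | s' != s) M)).
    apply: leq_sum => s' /andP[s'S s's].
    have [a sa] : exists a, s a != s' a.
      apply/existsP; apply: contraNT s's; rewrite negb_exists => /forallP ss'.
      by apply/eqP/ffunP => a; move/negPn/eqP: (ss' a).
    (* Sign vectors that agree somewhere fall under [card_sgsum_two]; opposite ones have no common
       solution, as it would force [g = - g]. *)
    have [/existsP[b /eqP sb]|nb] := boolP [exists b, s b == s' b].
      exact: card_sgsum_two sa sb.
    have ss' b : s b != s' b by move: nb; rewrite negb_exists => /forallP.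
    have gg : g + g != 0.
      by have [[b /eqP sb]|//] := Sg_ok _ _ sS s'S; rewrite (negbTE (ss' b)) in sb.
    apply: (@leq_trans 0) => //; rewrite leqn0 cards_eq0 -subset0.
    apply/subsetP => x; rewrite !inE (sgsum_negate _ ss') => /andP[/eqP xg /eqP xg'].
    by rewrite -{2}xg' xg subrr eqxx in gg.
  rewrite sum_nat_const leq_mul2r; apply/orP; right.
  by apply: leq_trans (max_card _) _; rewrite card_ffun card_ord card_bool.
rewrite -sum_nat_const.
apply: (@leq_trans (\sum_(s in Sg) (#|J s| + (d ^ 2 + 2 ^ d) * M))%N).
  exact: leq_sum.
rewrite big_split /= sum_nat_const leq_add2r.
apply: leq_trans (card_inj_image_in (@card_repsets_mem Sg g)).
rewrite -sum1_card [X in (_ <= X)%N]big_mkcond /=.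
under eq_bigr do rewrite -sum1_card big_mkcond /=.
rewrite exchange_big /=; apply: leq_sum => x _.
(* The [J s] with [s] in [Sg] are pairwise disjoint, so each [x] is counted at most once. *)
have [s /andP[sS xJ]|xJ] := pickP (fun s => (s \in Sg) && (x \in J s)); last first.
  rewrite big1 // => s sS; have := xJ s; rewrite sS /= => -> //.
move: (xJ); rewrite inE => /and3P[/eqP xg xi /forall_inP xu].
rewrite inE xi /= (_ : _ \in _); last first.
  by apply/repsetsP; exists s, x; split=> //; apply/injectiveP.
rewrite (bigD1 s) //= xJ big1 // => s' /andP[s'S s's].
by rewrite inE (negbTE (xu s' _)) // s'S.
Qed.

End SignedSums.

(** * Overlaps between representing sets *)

(** Enumerations of [T'] are sorted by the set [A] of positions landing in [T]: there are at most
    [2 ^ d] sign vectors times [d ^ #|A| * #|G| ^ (d - #|A|).-1] tuples, and the union has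
    [d + (d - #|A|)] elements. As [d <= Q = #|G| * p], the bound is worst for [#|A| = 1]; the at
    most [2 ^ d] choices of [A] complete [4 ^ d]. *)
Lemma overlap_le (R : realType) (G : finZmodType) (d : nat) (p : R)
    (Sg : {set {ffun 'I_d -> bool}}) (g : G) (T : {set G}) :
  0 <= p -> #|T| = d -> d%:R <= #|G|%:R * p ->
  \sum_(T' in repsets Sg g | (T' != T) && ~~ [disjoint T & T']) p ^+ #|T :|: T'|
    <= p ^+ d * (4 ^+ d * d%:R * (#|G|%:R * p) ^+ d.-1 / #|G|%:R).
Proof.
move=> p0 Td dQ; set n : R := #|G|%:R; set Q := n * p.
have n0 : 0 < n by rewrite ltr0n; apply/card_gt0P; exists 0.
have Q0 : 0 <= Q by rewrite mulr_ge0 // ltW.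
pose im (q : {ffun 'I_d -> bool} * {ffun 'I_d -> G}) := [set q.2 a | a : 'I_d].
pose C (T' : {set G}) :=
  [&& T' \in repsets Sg g, T' != T & ~~ [disjoint T & T']].
pose V (q : {ffun 'I_d -> bool} * {ffun 'I_d -> G}) :=
  [&& injectiveb q.2, sgsum q.1 q.2 == g & C (im q)].
pose hit (q : {ffun 'I_d -> bool} * {ffun 'I_d -> G}) := [set a | q.2 a \in T].
apply: (@le_trans _ _ (\sum_(q | V q) p ^+ #|T :|: im q|)).
  rewrite [leRHS](partition_big im C) /=; last by move=> q /and3P[].
  apply: ler_sum => T' CT'; have /and3P[/repsetsP[s [x [_ xi xg T'E]]] _ _] := CT'.
  rewrite (bigD1 (s, x)) /=; last first.
    by rewrite /V /im /= -T'E (CT' : C T') xg !eqxx !andbT; apply/injectiveP.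
  rewrite /im /= -T'E lerDl; apply: sumr_ge0 => q _; exact: exprn_ge0.
(* [A] is nonempty because [T'] meets [T], and not full because [T'] differs from [T] and has the
   same size. *)
rewrite (partition_big hit (fun A => (A != set0) && (A != setT))) /=; last first.
  move=> q /and3P[/injectiveP qi _ /and3P[_ qT qd]]; apply/andP; split.
    apply: contraNneq qd => h0; apply/pred0P => u /=; apply/negP => /andP[uT].
    by move=> /imsetP[a _ ua]; have := in_set0 a; rewrite -h0 inE -ua uT.
  apply: contraNneq qT => hT; rewrite eqEcard card_imset // card_ord Td leqnn andbT.
  by apply/subsetP => _ /imsetP[a _ ->]; have := in_setT a; rewrite -hT inE.
apply: (@le_trans _ _ (\sum_(A : {set 'I_d} | (A != set0) && (A != setT))
    2 ^+ d * (p ^+ d * (d%:R * Q ^+ d.-1 / n)))); last first.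
  rewrite sumr_const -[leLHS]mulr_natl.
  have -> : p ^+ d * (4 ^+ d * d%:R * Q ^+ d.-1 / n) =
            2 ^+ d * (2 ^+ d * (p ^+ d * (d%:R * Q ^+ d.-1 / n))).
    by rewrite (_ : 4 = 2 * 2 :> R) ?exprMn; [ring | ring].
  rewrite ler_wpM2r //.
    by rewrite !(mulr_ge0, exprn_ge0, ler0n, invr_ge0) // ltW.
  rewrite -natrX ler_nat; apply: leq_trans (max_card _) _.
  by rewrite -cardsT -powersetT card_powerset cardsT card_ord.
apply: ler_sum => A /andP[A0 AT].
have Ad : (#|A| < d)%N.
  have := @proper_card _ A setT; rewrite properT cardsT card_ord; exact.
have A_gt0 : (0 < #|A|)%N by rewrite card_gt0.
apply: (@le_trans _ _ (\sum_s \sum_(x : {ffun 'I_d -> G} |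
    (sgsum s x == g) && [forall a in A, x a \in T]) p ^+ (d + (d - #|A|)))).
  rewrite pair_big_dep /= big_mkcond [leRHS]big_mkcond /=; apply: ler_sum => q _.
  case: ifP => [/andP[/and3P[/injectiveP qi qg _] /eqP hA]|_]; last first.
    by case: ifP => // _; rewrite exprn_ge0.
  rewrite qg /= ifT; last by apply/forall_inP => a; rewrite -hA inE.
  suff -> : #|T :|: im q| = (d + (d - #|A|))%N by [].
  have cI : #|im q| = d by rewrite card_imset // card_ord.
  have -> : #|A| = #|T :&: im q|.
    rewrite -(card_imset _ qi); apply: eq_card => u; rewrite inE.
    apply/imsetP/andP => [[a]|[uT /imsetP[a _ ua]]].
      by rewrite -hA inE => aT ->; rewrite aT imset_f.
    by exists a; rewrite // -hA inE -ua.
  rewrite cardsU Td cI addnBA // -[X in (_ <= X)%N]Td; apply: subset_leq_card.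
  exact: subsetIl.
under eq_bigr do rewrite sumr_const.
apply: (@le_trans _ _ (\sum_(s : {ffun 'I_d -> bool})
    (d%:R ^+ #|A| * n ^+ (d - #|A|).-1) * p ^+ (d + (d - #|A|)))).
  apply: ler_sum => s _; rewrite -[leLHS]mulr_natl ler_wpM2r ?exprn_ge0 //.
  rewrite -!natrX -natrM ler_nat.
  by have := card_sgsum_in s g T AT; rewrite cardsE Td.
rewrite sumr_const card_ffun card_bool card_ord -[leLHS]mulr_natl natrX.
rewrite ler_wpM2l ?exprn_ge0 // exprD mulrCA ler_wpM2l ?exprn_ge0 //.
rewrite ler_pdivlMr //.
have -> : d%:R ^+ #|A| * n ^+ (d - #|A|).-1 * p ^+ (d - #|A|) * n =
          d%:R ^+ #|A| * Q ^+ (d - #|A|).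
  have : (0 < d - #|A|)%N by rewrite subn_gt0.
  by case: (d - #|A|)%N => // m _; rewrite /Q exprMn !exprS /=; ring.
(* All but one of the [#|A|] factors [d] are replaced by [Q]. *)
rewrite -[X in d%:R ^+ X](prednK A_gt0) exprS -mulrA ler_wpM2l //.
apply: (@le_trans _ _ (Q ^+ #|A|.-1 * Q ^+ (d - #|A|))).
  by rewrite ler_wpM2r ?exprn_ge0 // lerXn2r ?nnegrE.
by rewrite -exprD -[X in (X + _)%N]subn1 addnC addnBA // subnK ?subn1 // ltnW.
Qed.

(** * From representing sets to the diameter *)

Lemma walk_of_steps (G : finZmodType) (S : {set G}) (ts : seq G) :
  {in ts, forall t, (t \in S) || (- t \in S)} ->
  forall x, dist_le S (size ts) x (x + \sum_(t <- ts) t).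
Proof.
elim: ts => [|t ts IH] tS x; first by exists [::]; rewrite big_nil addr0.
have [] := IH _ (x + t); first by move=> u uts; apply: tS; rewrite inE uts orbT.
move=> w [wsz [wpath wlast]]; rewrite big_cons addrA.
(* The graph has no loops, so a zero step is skipped and the walk only gets shorter. *)
have [t0|t0] := eqVneq t 0.
  exists w; split; first exact: leq_trans wsz _.
  by rewrite t0 addr0 in wpath wlast *.
exists (x + t :: w); split=> //; split=> //=; rewrite wpath andbT /cayley_adj.
rewrite -subr_eq0 opprD addrA subrr sub0r oppr_eq0 t0 /=.
by rewrite addrAC subrr add0r; apply: tS; rewrite mem_head.
Qed.

Lemma diam_le_repsets (G : finZmodType) (d : nat) (S : {set G})
    (Sg : G -> {set {ffun 'I_d -> bool}}) :
  (forall g, g != 0 -> exists2 T, T \in repsets (Sg g) g & T \subset S) ->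
  diam_le S d.
Proof.
move=> reps x y; have [->|xy] := eqVneq y x; first by exists [::].
have [|T /repsetsP[s [f [_ _ fg TE]]] TS] := reps (y - x); first by rewrite subr_eq0.
have := @walk_of_steps G S [seq (if s a then - f a else f a) | a <- enum 'I_d].
rewrite size_map size_enum_ord big_map big_enum => /(_ _ x).
rewrite -[X in x + X]/(sgsum s f) fg addrCA subrr addr0; apply.
move=> _ /mapP[a _ ->]; have faS : f a \in S.
  by apply: (subsetP TS); rewrite TE imset_f.
by case: ifP => _; rewrite ?opprK faS ?orbT.
Qed.

Lemma prob_diam_gt_le (R : realType) (G : finZmodType) (d : nat) (p : R)
    (Sg : G -> {set {ffun 'I_d -> bool}}) : 0 <= p <= 1 ->
  prob_diam_gt G p d <=
    \sum_(g | g != 0) expect p (avoids (enum (repsets (Sg g) g))).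
Proof.
move=> p01; rewrite -expect_sum /prob_diam_gt big_mkcond /=.
apply: ler_sum => S _.
have s0 : 0 <= \sum_(g | g != 0) avoids (enum (repsets (Sg g) g)) S :> R.
  by apply: sumr_ge0 => g _; exact: avoids_ge0.
case: ifPn => [|_]; last by rewrite mulr_ge0 ?setprob_ge0.
move=> /asboolPn ndiam; rewrite ler_peMr ?setprob_ge0 //.
have [g /andP[g0 gS]|noG] := pickP (fun g => (g != 0) &&
    all (fun T : {set G} => ~~ (T \subset S)) (enum (repsets (Sg g) g))).
  rewrite (bigD1 g) //= /avoids gS lerDl; apply: sumr_ge0 => ? _.
  exact: avoids_ge0.
exfalso; apply: ndiam; apply: (@diam_le_repsets _ _ _ Sg) => g g0.
have := noG g; rewrite g0 => /negbT/allPn[T]; rewrite mem_enum negbK => *.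
by exists T.
Qed.

(** * Numerical estimates *)

Lemma fact_le_expn d : (d`! <= d ^ d)%N.
Proof.
suff fact_le k : (k <= d -> k`! <= d ^ k)%N by exact: fact_le.
by elim: k => // k IH kd; rewrite factS expnS leq_mul // IH // ltnW.
Qed.

Lemma expn2_le_fact d : (2 ^ d.+1 <= 2 * (d.+1)`!)%N.
Proof.
elim: d => // d IH; rewrite expnS factS; apply: leq_trans (leq_mul (leqnn 2) IH) _.
by rewrite !leq_mul.
Qed.

Section Estimates.
Context {R : realType}.
Implicit Types (eps L n Q : R) (d : nat).

(** The quantity is [Q ^+ d / n] for [n = N] and [Q = N * p] with [p] at the threshold; hence
    [Q ^+ d >= n]. *)
Lemma threshold_count_ge1 eps L d : 0 < eps -> 2 <= L -> (0 < d)%N ->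
  1 <= (d`!)%:R * (1 + eps) * L / 2 ^+ d.
Proof.
move=> e0 L2; case: d => // d _.
have d2 : 2 ^+ d.+1 <= 2 * ((d.+1)`!)%:R :> R.
  by rewrite -natrX -natrM ler_nat expn2_le_fact.
rewrite ler_pdivlMr ?exprn_gt0 // mul1r; apply: (le_trans d2).
rewrite mulrC -mulrA ler_wpM2l //; nra.
Qed.

Lemma le_of_root_bound eps L n Q d : 0 < eps -> 2 <= L -> (0 < d)%N ->
  L ^+ (2 * d ^ 2) <= n -> 0 <= Q ->
  Q ^+ d = n * ((d`!)%:R * (1 + eps) * L / 2 ^+ d) -> L ^+ (2 * d) <= Q.
Proof.
move=> e0 L2 d0 Ln Q0 Qd; have L0 : 0 <= L by lra.
rewrite -(ler_pXn2r d0) ?nnegrE ?exprn_ge0 // -exprM -mulnA mulnn Qd.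
apply: (le_trans Ln); apply: ler_peMr; last exact: threshold_count_ge1.
by apply: le_trans Ln; rewrite exprn_ge0.
Qed.

(** The left side is the loss term of [card_repsets] relative to its main term
    [#|Sg| * #|G| ^ d.-1], with [n = #|G|]. *)
Lemma degenerate_ratio_le L n d : 2 <= L -> (1 < d)%N -> (d ^ 2)%:R <= L ->
  L ^+ (2 * d ^ 2) <= n -> ((d ^ 2 + 2 ^ d) * 2)%:R / n <= 4 / L.
Proof.
move=> L2 d1 dL Ln; have L0 : 0 < L by lra.
have n0 : 0 < n by apply: lt_le_trans Ln; rewrite exprn_gt0.
have Xn k : (k <= 2 * d ^ 2)%N -> L ^+ k <= n.
  by move=> kd; apply: le_trans Ln; rewrite ler_weXn2l //; lra.
have n1 : L * L <= n.
  by rewrite -expr2; apply: Xn; rewrite leq_pmulr // expn_gt0 (ltnW d1).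
have n2 : L ^+ d * L <= n.
  rewrite -exprSr; apply: Xn; rewrite mul2n -addnn -addn1 leq_add //.
    by rewrite -[X in (X <= _)%N]expn1 leq_pexp2l // ltnW.
  by rewrite expn_gt0 (ltnW d1).
have l2 : 2 ^+ d <= L ^+ d by rewrite lerXn2r ?nnegrE // ltW.
rewrite ler_pdivrMr // mulrAC ler_pdivlMr // natrM natrD !natrX.
have : d%:R ^+ 2 * L <= L * L by rewrite -natrX ler_wpM2r // ltW.
have : 2 ^+ d * L <= L ^+ d * L by rewrite ler_wpM2r // ltW.
lra.
Qed.

(** The left side is the relative overlap from [overlap_le]. Since
    [Q ^+ d.-1 / n = Q ^+ d / (n * Q)], it equals [2 ^+ d * (1 + eps) * L / Q] times [d] and [d]
    factorial; the last two have product at most [L ^+ d], while [Q] is at least [L ^+ (2 * d)]. *)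
Lemma overlap_ratio_le eps L n Q d : 0 < eps -> 2 <= L -> (1 < d)%N ->
  (d ^ 2)%:R <= L -> L ^+ (2 * d ^ 2) <= n -> 0 <= Q ->
  Q ^+ d = n * ((d`!)%:R * (1 + eps) * L / 2 ^+ d) ->
  4 ^+ d * d%:R * Q ^+ d.-1 / n <= 4 * (1 + eps) / L.
Proof.
move=> e0 L2 d1 dL Ln Q0 Qd; have L0 : 0 < L by lra.
have d0 := ltnW d1.
have n0 : 0 < n by apply: lt_le_trans Ln; rewrite exprn_gt0.
have QL := le_of_root_bound e0 L2 d0 Ln Q0 Qd.
have Qgt0 : 0 < Q by apply: lt_le_trans QL; rewrite exprn_gt0.
have -> : 4 ^+ d * d%:R * Q ^+ d.-1 / n =
          2 ^+ d * (d%:R * (d`!)%:R) * (1 + eps) * L / Q.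
  apply: (mulIf (lt0r_neq0 Qgt0)); rewrite mulfVK ?lt0r_neq0 //.
  rewrite mulrAC -[_ * _ * Q]mulrA -exprSr prednK // Qd.
  rewrite (_ : 4 = 2 * 2 :> R) ?exprMn; last by ring.
  by field; rewrite !lt0r_neq0 ?exprn_gt0.
rewrite ler_pdivrMr // [leRHS]mulrAC ler_pdivlMr //.
have ddL : d%:R * (d`!)%:R <= L ^+ d.
  apply: (@le_trans _ _ ((d ^ 2)%:R ^+ d)); last by rewrite lerXn2r ?nnegrE // ltW.
  rewrite -natrM -natrX ler_nat -expnM mul2n -addnn expnD leq_mul ?fact_le_expn //.
  by rewrite -[X in (X <= _)%N]expn1 leq_pexp2l.
have pL : 2 ^+ d * L ^+ d * L * L <= 4 * L ^+ (2 * d).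
  (* Taking out two factors [2] leaves [2 ^+ d <= L ^+ d] for the new [d], which is the old one
     minus two. *)
  case: d d1 {d0 dL Ln Qd QL ddL} => [|[|d]] // _.
  have l2 : 2 ^+ d <= L ^+ d by rewrite lerXn2r ?nnegrE // ltW.
  rewrite mul2n -addnn exprD !exprS.
  have -> : 2 * (2 * 2 ^+ d) * (L * (L * L ^+ d)) * L * L =
            4 * (L * L * L * L * L ^+ d) * 2 ^+ d by ring.
  have -> : 4 * (L * (L * L ^+ d) * (L * (L * L ^+ d))) =
            4 * (L * L * L * L * L ^+ d) * L ^+ d by ring.
  by rewrite ler_wpM2l // !(mulr_ge0, exprn_ge0) // ltW.
have -> : 2 ^+ d * (d%:R * (d`!)%:R) * (1 + eps) * L * L =
  (1 + eps) * (2 ^+ d * (d%:R * (d`!)%:R) * L * L) by ring.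
have -> : 4 * (1 + eps) * Q = (1 + eps) * (4 * Q) by ring.
rewrite ler_wpM2l //; first by lra.
apply: (@le_trans _ _ (2 ^+ d * L ^+ d * L * L)).
  by rewrite !ler_wpM2r ?(ltW L0) // ler_wpM2l ?exprn_ge0.
by apply: (le_trans pL); rewrite ler_wpM2l.
Qed.

(** With [L = ln N], squaring [d <= dN gamma N] gives [2 * d ^ 2 * ln L <= L]. Exponentiating yields
    the second bound, and [ln L >= 1] the first. *)
Lemma dN_bounds (gamma : R) (N d : nat) : 0 < gamma < 1 ->
  expR 1 <= ln N%:R :> R -> d%:R <= dN gamma N ->
  (d ^ 2)%:R <= ln N%:R :> R /\ ln N%:R ^+ (2 * d ^ 2) <= N%:R :> R.
Proof.
move=> /andP[g0 g1] Le dN_le; set L : R := ln N%:R in Le *.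
have L0 : 0 < L by apply: lt_le_trans Le; exact: expR_gt0.
have lnL1 : 1 <= ln L by rewrite -[X in X <= _]expRK ler_ln ?posrE ?expR_gt0.
have N0 : 0 < N%:R :> R.
  by rewrite ltNge; apply/negP => /ln0; rewrite -/L => L00; rewrite L00 ltxx in L0.
have q0 : 0 <= L / (2 * ln L) by rewrite divr_ge0 ?(ltW L0) //; lra.
have d2 : 2 * (d ^ 2)%:R * ln L <= L.
  rewrite -mulrA mulrCA -ler_pdivlMr; last by lra.
  rewrite natrX -[leRHS]sqr_sqrtr // lerXn2r ?nnegrE ?sqrtr_ge0 //.
  apply: (le_trans dN_le); rewrite /dN -/L ler_piMl ?sqrtr_ge0 //; lra.
split.
  have : 0 <= (d ^ 2)%:R :> R by []; nra.
rewrite -[X in X ^+ _]lnK ?posrE // -expRM_natl -[leRHS]lnK ?posrE // ler_expR.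
by rewrite natrM.
Qed.

Lemma p_threshold_pow eps (N d : nat) : 0 < eps -> (0 < d)%N -> (1 < N)%N ->
  p_threshold eps N d ^+ d =
  (d`!)%:R * (1 + eps) / 2 ^+ d * (ln N%:R / N%:R ^+ d.-1).
Proof.
move=> e0 d0 N1; rewrite /p_threshold -powR_mulrn ?powR_ge0 // -powRrM.
rewrite mulVf ?pnatr_eq0 -?lt0n // powRr1 //.
rewrite !(mulr_ge0, divr_ge0, exprn_ge0) // ?ln_ge0 ?ler1n ?(ltnW N1) //; lra.
Qed.

End Estimates.

(** * Failure probability of a single group element *)

(** [#|Sg| / 2 ^ d] is the share of sign vectors in use. The constant [8 + 4 * eps] is
    [4 + 4 * (1 + eps)], from the relative losses [4 / L] to degenerate tuples and
    [4 * (1 + eps) / L] to overlaps. *)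
Lemma expect_avoids_repsets (R : realType) (G : finZmodType) (d : nat)
    (bit : G -> bool) (Sg : {set {ffun 'I_d -> bool}}) (g : G) (eps L p : R) :
  (forall u v, u + u = v + v -> bit u = bit v -> u = v) ->
  0 < eps -> 2 <= L -> 4 * (1 + eps) <= L -> (1 < d)%N -> g != 0 ->
  {in Sg &, forall s s' : {ffun 'I_d -> bool}, (exists b, s b = s' b) \/ g + g != 0} ->
  (d ^ 2)%:R <= L -> L ^+ (2 * d ^ 2) <= #|G|%:R -> 0 <= p <= 1 ->
  p ^+ d = (d`!)%:R * (1 + eps) / 2 ^+ d * (L / #|G|%:R ^+ d.-1) ->
  expect p (avoids (enum (repsets Sg g))) <=
    expR (- (#|Sg|%:R / 2 ^+ d * ((1 + eps) * (L - (8 + 4 * eps))))).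
Proof.
move=> bit_inj e0 L2 L4 d1 g0 Sg_ok dL Ln p01 pd.
have p0 : 0 <= p by case/andP: p01.
have d0 := ltnW d1; have L0 : 0 < L by lra.
set n : R := #|G|%:R in Ln pd *.
have n0 : 0 < n by apply: lt_le_trans Ln; rewrite exprn_gt0.
set F := repsets Sg g; pose Q := n * p.
have Q0 : 0 <= Q by rewrite mulr_ge0 // ltW.
have Qd : Q ^+ d = n * ((d`!)%:R * (1 + eps) * L / 2 ^+ d).
  rewrite exprMn pd -{1}(prednK d0) exprS.
  by field; rewrite !lt0r_neq0 ?exprn_gt0.
have dQ : d%:R <= Q.
  apply: le_trans (le_of_root_bound e0 L2 d0 Ln Q0 Qd).
  apply: (@le_trans _ _ L).
    apply: le_trans dL; rewrite ler_nat -[X in (X <= _)%N]expn1.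
    by rewrite leq_pexp2l.
  rewrite -[leLHS]expr1 ler_weXn2l ?muln_gt0 //; lra.
pose rho := 4 ^+ d * d%:R * Q ^+ d.-1 / n.
have rho_le : rho <= 4 * (1 + eps) / L := overlap_ratio_le e0 L2 d1 dL Ln Q0 Qd.
have := janson p01 (@card_repsets_mem G d Sg g) (delta := p ^+ d * rho).
move=> /(_ _)/le_trans; apply.
  by move=> T TF; apply: overlap_le => //; exact: card_repsets_mem TF.
rewrite ler_expR lerN2 -/F.
set kappa := _ / 2 ^+ d; pose u := (1 + eps) * L.
have k0 : 0 <= kappa by rewrite divr_ge0 // exprn_ge0.
pose E : R := ((d ^ 2 + 2 ^ d) * 2)%:R / n.
have E_le : E <= 4 / L := degenerate_ratio_le L2 d1 dL Ln.
have Fp : kappa * u * (1 - E) <= #|F|%:R * p ^+ d.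
  have := card_repsets bit_inj d1 g0 Sg_ok; rewrite -/F -(ler_nat R).
  have -> : d.-1 = (d - 2).+1 by rewrite -subn1 subnSK.
  rewrite natrD !natrM !natrX exprS -/n.
  set m := n ^+ (d - 2); set e := (d ^ 2 + 2 ^ d)%:R => cF.
  have m0 : 0 < m by rewrite exprn_gt0.
  have P0 : 0 < 2 ^+ d :> R by rewrite exprn_gt0.
  have c0 : 0 <= u / (2 ^+ d * (n * m)).
    by rewrite !(divr_ge0, mulr_ge0) ?exprn_ge0 ?ltW //; lra.
  have := ler_wpM2r c0 cF.
  have -> : #|F|%:R * p ^+ d = #|F|%:R * (d`!)%:R * (u / (2 ^+ d * (n * m))).
    rewrite pd (_ : d.-1 = (d - 2).+1) ?exprS -/m; last by rewrite -subn1 subnSK.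
    by rewrite /u; field; rewrite !lt0r_neq0.
  have -> : kappa * u * (1 - E) = #|Sg|%:R * (n * m) * (u / (2 ^+ d * (n * m))) -
      #|Sg|%:R * (e * (2 * m)) * (u / (2 ^+ d * (n * m))).
    by rewrite /kappa /E natrM -/e; field; rewrite !lt0r_neq0.
  by rewrite mulrDl lerBlDr.
have r1 : 0 <= 1 - rho.
  rewrite subr_ge0; apply: (le_trans rho_le); rewrite ler_pdivrMr //; lra.
have -> : #|F|%:R * (p ^+ d - p ^+ d * rho) = #|F|%:R * p ^+ d * (1 - rho) by ring.
apply: le_trans (ler_wpM2r r1 Fp).
have -> : kappa * u * (1 - E) * (1 - rho) =
  kappa * ((1 + eps) * (L * ((1 - E) * (1 - rho)))) by rewrite /u; ring.
have e1 : 0 <= 1 + eps by lra.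
do 2! rewrite ler_wpM2l //.
have -> : L - (8 + 4 * eps) = L * (1 - 4 / L - 4 * (1 + eps) / L).
  by field; rewrite lt0r_neq0.
rewrite ler_wpM2l ?(ltW L0) //.
(* As [E * rho >= 0], the product [(1 - E) * (1 - rho)] is at least [1 - E - rho]. *)
have : 0 <= E by rewrite divr_ge0 // ltW.
have : 0 <= rho by rewrite /rho divr_ge0 ?(ltW n0) // !(mulr_ge0, exprn_ge0).
nra.
Qed.

(** * Cyclic groups and the conclusion *)

Lemma card_signs_fixed d (i : 'I_d) :
  #|[set s : {ffun 'I_d -> bool} | ~~ s i]| = (2 ^ d.-1)%N.
Proof.
pose H a : pred bool := fun b => (a == i) ==> ~~ b.
have -> : #|[set s : {ffun 'I_d -> bool} | ~~ s i]| = #|family H|.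
  apply: eq_card => s; rewrite inE; apply/idP/familyP => [si a|/(_ i)].
    by rewrite unfold_in; apply/implyP => /eqP->.
  by rewrite unfold_in /H eqxx.
rewrite card_family_prod (bigD1 i) //= (_ : #|H i| = 1%N); last first.
  by rewrite -(card1 false); apply: eq_card => -[]; rewrite !unfold_in /H eqxx.
rewrite mul1n (eq_bigr (fun=> 2%N)); last first.
  move=> a /negbTE ai; rewrite -card_bool; apply: eq_card => b.
  by rewrite unfold_in /H ai.
by rewrite prod_nat_const (cardC1 i) card_ord.
Qed.

(** Reducing [2 * u] modulo [N] subtracts [0] or [N], and the bit tells which. *)
Lemma Zp_double_inj N (u v : 'Z_N) : (1 < N)%N -> u + u = v + v ->
  (2 * u < N)%N = (2 * v < N)%N -> u = v.
Proof.
case: N u v => [|[|n]] // u v _ /(congr1 val) /=; set N := n.+2.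
rewrite !addnn -!mul2n => uv bit.
have uN : (u < N)%N := ltn_ord u.
have vN : (v < N)%N := ltn_ord v.
have reduce w : (w < N)%N ->
    ((2 * w) %% N = if 2 * w < N then 2 * w else 2 * w - N)%N.
  move=> wN; case: ifPn => [/modn_small //|]; rewrite -leqNgt => Nw.
  by rewrite -{1}(subnK Nw) modnDr modn_small //; lia.
by apply: val_inj => /=; move: uv; rewrite !reduce // bit; case: ifPn; lia.
Qed.

Lemma expRN_le (R : realType) (y : R) : 0 < y -> expR (- y) <= y^-1.
Proof.
move=> y0; rewrite expRN lef_pV2 ?posrE ?expR_gt0 //.
by have := expR_ge1Dx y; lra.
Qed.

Theorem theorem5 (R : realType) (eps gamma : R) :
  0 < eps -> 0 < gamma < 1 ->
  forall eta : R, 0 < eta ->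
  exists N0 : nat, forall N : nat, (2 <= N)%N -> (N0 <= N)%N ->
  forall (d : nat) (p : R),
    (2 <= d)%N -> d%:R <= dN gamma N ->
    0 <= p <= 1 -> p_threshold eps N d <= p ->
    prob_diam_gt [the finZmodType of 'Z_N] p d < eta.
Proof.
move=> eps0 gamma01 eta eta0.
(* For [e1] and [e2] below, [N * e1 = expR (K - eps * L)] and [e2 <= expR (K - L / 2)]; by
   [expRN_le], [M / L] then bounds [N * e1 + 2 * e2]. *)
pose C : R := 8 + 4 * eps; pose K : R := (1 + eps) * C.
pose M : R := expR K * (eps^-1 + 4).
have M0 : 0 < M by rewrite mulr_gt0 ?expR_gt0 // addr_gt0 ?invr_gt0.
have K0 : 0 <= K by rewrite /K /C; nra.
(* The summands secure, in turn, [ln L >= 1] for [dN_bounds], the two lower bounds on [L] for the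
   single-element estimate, and [M / L < eta]. *)
pose L0 : R := expR 1 + 2 + 4 * (1 + eps) + M / eta.
have ML0 : 0 < M / eta by rewrite divr_gt0.
exists (Num.trunc (expR L0)).+1 => N N2 N_ge d p d2 d_le p01 p_ge.
set G : finZmodType := [the finZmodType of 'Z_N].
have cG : #|G| = N by rewrite card_ord Zp_cast.
set L : R := ln N%:R.
have Npos : 0 < N%:R :> R by rewrite ltr0n ltnW.
have LL0 : L0 < L.
  rewrite -[L0]expRK ltr_ln ?posrE ?expR_gt0 //.
  by apply: (lt_le_trans (truncnS_gt _)); rewrite ler_nat.
have e1_gt0 : 0 < expR 1 :> R by exact: expR_gt0.
have [Le L2 L4 LM] : [/\ expR 1 <= L, 2 <= L, 4 * (1 + eps) <= L & M / eta < L].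
  by rewrite /L0 in LL0; split; lra.
have L_gt0 : 0 < L by lra.
have [dL LN] := dN_bounds gamma01 Le d_le; rewrite -/L in dL LN.
set p0 := p_threshold eps N d in p_ge.
have p00 : 0 <= p0 by exact: powR_ge0.
have p001 : 0 <= p0 <= 1 by rewrite p00 (le_trans p_ge) //; case/andP: p01.
have p0d := p_threshold_pow eps0 (ltnW d2) N2; rewrite -/p0 -/L in p0d.
pose bit (u : G) := (2 * (u : 'Z_N) < N)%N.
have bit_inj (u v : G) : u + u = v + v -> bit u = bit v -> u = v.
  exact: Zp_double_inj.
pose i0 : 'I_d := Ordinal (ltnW d2).
(* If [g + g = 0], a fixed first sign keeps one of each pair of opposite sign vectors. *)
pose Sg (g : G) : {set {ffun 'I_d -> bool}} :=
  if g + g == 0 then [set s : {ffun 'I_d -> bool} | ~~ s i0] else setT.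
have Sg_ok g : {in Sg g &, forall s s' : {ffun 'I_d -> bool},
    (exists b, s b = s' b) \/ g + g != 0}.
  rewrite /Sg; case: eqP => [_|_] s s'; last by right.
  by rewrite !inE => /negbTE s0 /negbTE s'0; left; exists i0; rewrite s0 s'0.
pose e1 : R := expR (- ((1 + eps) * (L - C))).
pose e2 : R := expR (- (2^-1 * ((1 + eps) * (L - C)))).
have fail g : g != 0 -> expect p (avoids (enum (repsets (Sg g) g))) <=
    e1 + (if g + g == 0 then e2 else 0).
  (* Failure is no likelier for larger [p], so [p] is lowered to [p0], whose [d]-th power is known
     exactly. *)
  move=> g0; apply: (@le_trans _ _ (expect p0 (avoids (enum (repsets (Sg g) g))))).
    apply: expect_antitone => //; first by case/andP: p01.
    by move=> *; exact: avoids_antitone.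
  rewrite -cG in LN p0d.
  apply: le_trans (expect_avoids_repsets bit_inj eps0 L2 L4 d2 g0 (@Sg_ok g)
    dL LN p001 p0d) _.
  rewrite /Sg; case: eqP => _.
    have -> : #|[set s : {ffun 'I_d -> bool} | ~~ s i0]|%:R / 2 ^+ d = 2^-1 :> R.
      rewrite card_signs_fixed natrX -[X in _ / _ ^+ X](prednK (ltnW d2)) exprS.
      by field; rewrite expf_neq0.
    rewrite -/C -/e2.
    by rewrite lerDr ltW ?expR_gt0.
  rewrite cardsT card_ffun card_bool card_ord natrX divff ?expf_neq0 // mul1r.
  by rewrite addr0.
apply: le_lt_trans (prob_diam_gt_le Sg p01) _.
apply: (@le_lt_trans _ _ (N%:R * e1 + 2 * e2)).
  apply: (@le_trans _ _ (\sum_(g : G) (e1 + (if g + g == 0 then e2 else 0)))).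
    rewrite big_mkcond; apply: ler_sum => g _; case: ifP => [/fail //|_].
    by rewrite addr_ge0 ?(ltW (expR_gt0 _)) //; case: ifP => // _; rewrite ltW ?expR_gt0.
  rewrite big_split /= sumr_const -[e1 *+ _]mulr_natl cG lerD2l -big_mkcond /=.
  rewrite sumr_const -[leLHS]mulr_natl ler_wpM2r ?(ltW (expR_gt0 _)) // ler_nat.
  (* The bit is injective on the solutions of [g + g = 0], so there are at most two. *)
  rewrite -card_bool -(card_in_imset (f := bit)) ?max_card //.
  move=> u v u0 v0; apply: bit_inj.
  by rewrite (eqP (u0 : u + u == 0)) (eqP (v0 : v + v == 0)).
have Ne1 : N%:R * e1 <= expR K * (eps * L)^-1.
  rewrite -[N%:R]lnK ?posrE // -/L -expRD.
  have -> : L + - ((1 + eps) * (L - C)) = K + - (eps * L) by rewrite /K; ring.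
  by rewrite expRD ler_wpM2l ?(ltW (expR_gt0 _)) // expRN_le // mulr_gt0.
have Ne2 : e2 <= expR K * (L / 2)^-1.
  apply: (@le_trans _ _ (expR (K + - (L / 2)))).
    by rewrite ler_expR; rewrite /K in K0 *; nra.
  by rewrite expRD ler_wpM2l ?(ltW (expR_gt0 _)) // expRN_le // divr_gt0.
apply: (@le_lt_trans _ _ (M / L)); last first.
  by rewrite ltr_pdivrMr // mulrC -ltr_pdivrMr.
have -> : M / L = expR K * (eps * L)^-1 + 2 * (expR K * (L / 2)^-1).
  by rewrite /M; field; rewrite !lt0r_neq0.
by apply: lerD => //; rewrite ler_wpM2l.
Qed.
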